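(* For every integer $n\ge 1$, the two triplets of set-valued/word-valued statistics $$(\mathrm{Iligne},\ \mathrm{sort}\circ \mathrm{Mc},\ \mathrm{El}\circ \mathrm{Mc})\quad\text{and}\quad(\mathrm{Iligne},\ \mathrm{sort}\circ \mathrm{Ic},\ \mathrm{El}\circ \mathrm{Ic})$$ are equidistributed on the symmetric group $\mathfrak{S}_n$; that is, for every triple $(A,w,B)$ with $A,B\subseteq\{1,\dots,n-1\}$ and $w$ a word of length $n$ with nonnegative integer letters, the number of $\sigma\in\mathfrak{S}_n$ with $(\mathrm{Iligne}\,\sigma,\ \mathrm{sort}(\mathrm{Mc}\,\sigma),\ \mathrm{El}(\mathrm{Mc}\,\sigma))=(A,w,B)$ equals the number of $\sigma\in\mathfrak{S}_n$ with $(\mathrm{Iligne}\,\sigma,\ \mathrm{sort}(\mathrm{Ic}\,\sigma),\ \mathrm{El}(\mathrm{Ic}\,\sigma))=(A,w,B)$.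
   Context: Permutations $\sigma\in\mathfrak{S}_n$ are written as words $\sigma=x_1x_2\cdots x_n$ with $x_i=\sigma(i)$. For a word $w=y_1\cdots y_m$ with integer letters, $\mathrm{maj}\,w=\sum\{i\mid 1\le i\le m-1,\ y_i>y_{i+1}\}$. The ligne of route of $\sigma$ is $\mathrm{Ligne}\,\sigma=\{i\mid 1\le i\le n-1,\ x_i>x_{i+1}\}$, and $\mathrm{Iligne}\,\sigma=\mathrm{Ligne}\,\sigma^{-1}$. A word $d_1d_2\cdots d_n$ of integers is subdiagonal if $0\le d_i\le n-i$ for all $i=1,\dots,n$. Lc-code: $\mathrm{Lc}\,\sigma=d_1\cdots d_n$ with $d_i=\#\{j\mid i+1\le j\le n,\ x_i>x_j\}$. Define $\mathrm{Ic}\,\sigma=\mathrm{Lc}(\sigma^{-1})$. Mc-code: $\mathrm{Mc}\,\sigma=d_1\cdots d_n$ with $d_i=\mathrm{maj}(\sigma^{(i)})-\mathrm{maj}(\sigma^{(i+1)})$, where $\sigma^{(i)}$ is the subword of $\sigma$ obtained by erasing the letters smaller than $i$ (so $\sigma^{(n+1)}$ is the empty word, with $\mathrm{maj}=0$). Both $\mathrm{Ic}$ and $\mathrm{Mc}$ are bijections from $\mathfrak{S}_n$ onto the set of subdiagonal words of length $n$. The set-valued statistic $\mathrm{El}$ on subdiagonal words is defined by $\mathrm{El}(\mathrm{Mc}\,\sigma)=\mathrm{Ligne}\,\sigma$, i.e. $\mathrm{El}(d)=\mathrm{Ligne}(\mathrm{Mc}^{-1}(d))$. For a word $w$, $\mathrm{sort}\,w$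 is the nondecreasing rearrangement of $w$. *)

(* Defs.v *)
From mathcomp Require Import all_boot all_fingroup.

Set Implicit Arguments.
Unset Strict Implicit.
Unset Printing Implicit Defensive.

(* 'S_n permutes {0, ..., n-1}; the word x_1 ... x_n has letters in {1, ..., n}. *)
Definition word_of (n : nat) (s : 'S_n) : seq nat :=
  [seq (s i).+1 | i <- enum 'I_n].

(* [nth 0 w i.-1] is the i-th letter y_i of w. *)
Definition maj (w : seq nat) : nat :=
  \sum_(1 <= i < size w | nth 0 w i < nth 0 w i.-1) i.

(* Subsets of {1, ..., n-1} are encoded by value in {set 'I_n}: the ordinal of
   value i stands for the position i itself (not i+1), and 0 never occurs. *)
Definition Ligne (n : nat) (s : 'S_n) : {set 'I_n} :=
  [set i : 'I_n |
    (0 < i) && (nth 0 (word_of s) i < nth 0 (word_of s) i.-1)].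

Definition Iligne (n : nat) (s : 'S_n) : {set 'I_n} := Ligne (s^-1)%g.

Definition Lc (n : nat) (s : 'S_n) : seq nat :=
  [seq #|[set j : 'I_n | (i < j) && (s j < s i)]| | i : 'I_n <- enum 'I_n].

Definition Ic (n : nat) (s : 'S_n) : seq nat := Lc (s^-1)%g.

Definition erase_below (i : nat) (w : seq nat) : seq nat :=
  [seq x <- w | i <= x].

(* The subtraction on nat is never truncated: see [maj_erase_below]. *)
Definition Mc (n : nat) (s : 'S_n) : seq nat :=
  [seq maj (erase_below i (word_of s)) - maj (erase_below i.+1 (word_of s))
  | i <- iota 1 n].

(* El d = Ligne (Mc^-1 d).  Mc is a bijection onto the subdiagonal words of
   length n, so the picked s is unique and always exists on such words; the
   value set0 is only taken on words that are not subdiagonal of length n. *)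
Definition El (n : nat) (d : seq nat) : {set 'I_n} :=
  if [pick s : 'S_n | Mc s == d] is Some s then Ligne s else set0.

(* maj with the positions numbered from k instead of 1. *)
Fixpoint maj_from (k : nat) (w : seq nat) : nat :=
  if w is a :: w' then
    (if w' is b :: _ then (if b < a then k else 0) else 0) + maj_from k.+1 w'
  else 0.

Lemma maj_fromE k w :
  maj_from k w = \sum_(1 <= i < size w | nth 0 w i < nth 0 w i.-1) (k + i.-1).
Proof.
elim: w k => [|a [|b w] IH] k; first by rewrite big_geq.
  by rewrite /= big_geq.
rewrite [LHS]/= -/(maj_from k.+1 (b :: w)) IH [size _]/=.
rewrite [RHS]big_mkcond big_ltn //= addn0; congr (_ + _).
rewrite [RHS]big_add1 /= [LHS]big_mkcond /= !big_nat; apply: eq_bigr => -[|i] // _ /=.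
by rewrite addSnnS.
Qed.

Lemma majE w : maj w = maj_from 1 w.
Proof.
rewrite maj_fromE /maj big_nat_cond [RHS]big_nat_cond.
by apply: eq_bigr => -[|i] // /andP[].
Qed.

Lemma maj_fromS k w : maj_from k w <= maj_from k.+1 w.
Proof.
elim: w k => //= a w IH k; apply: leq_add => //.
by case: w {IH} => // b w; case: ifP.
Qed.

Lemma maj_from_erase k i w : all (leq i) w ->
  maj_from k (erase_below i.+1 w) <= maj_from k w.
Proof.
elim: w k => //= a w IH k /andP[le_ia w_i].
case: ltnP => [lt_ia | le_ai] /=; last first.
  apply: leq_trans (IH k w_i) _; apply: leq_trans (maj_fromS _ _) _.
  exact: leq_addl.
apply: leq_add; last exact: IH.
case: w w_i {IH} => //= b w /andP[le_ib _].
case: (ltnP i b) => // le_bi.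
rewrite (leq_ltn_trans le_bi lt_ia).
by case: (erase_below _ w) => // c v; case: ifP.
Qed.

Lemma maj_erase_below i w :
  maj (erase_below i.+1 w) <= maj (erase_below i w).
Proof.
have -> : erase_below i.+1 w = erase_below i.+1 (erase_below i w).
  rewrite /erase_below -filter_predI; apply: eq_filter => x /=.
  by case: (ltnP i x) => //= /ltnW ->.
by rewrite !majE; apply/maj_from_erase/filter_all.
Qed.

(* Main.v *)
Require Import Defs.
From mathcomp Require Import all_boot all_fingroup.
From mathcomp Require Import zify.

Set Implicit Arguments.
Unset Strict Implicit.
Unset Printing Implicit Defensive.

(** A permutation is built by inserting the letters n, n-1, ..., 1 in this
    order, each in some slot of the current word; slot j lies after the j-th
    letter.  The word of successive slots is [rev (Ic s)], and the word of
    successive increments of maj is [rev (Mc s)].  Inserting a new smallest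
    letter changes the descent word, and increases maj, in a way that depends
    only on the slot and the current descent word (the state), not on the
    letters.  Hence Mc is computed from Ic by relabelling slots, and the
    ligne of route is the final state, reached by reading Ic as slots or Mc as
    labels.

    Iligne s is contained in A iff [rev (Ic s)] is weakly decreasing on the
    blocks cut out by A.  For a weakly decreasing block ds of labels,
    [block_slots] gives a weakly decreasing block of slots whose labels
    rearrange ds and which leads to the same state as ds.  It is injective,
    hence bijective, which proves the theorem with "Iligne = A" replaced by
    "Iligne contained in A"; one concludes by induction on A. *)

(** * Slots of a state and their labels *)

Lemma geq_trans : transitive geq.
Proof. by move=> x y z /= le1 le2; apply: leq_trans le2 le1. Qed.

(* A state is [true] (an imaginary descent in front of the word) followed by the
   descent word of y_1 ... y_m and a final [false] (the end of the word, if
   m > 0).  Inserting a smallest letter in slot j splits bit j into a descent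
   followed by an ascent. *)
Definition insert_slot (E : seq bool) (j : nat) : seq bool :=
  take j E ++ [:: true, false & drop j.+1 E].

(* The increment of maj: every descent on the right moves by one, and a new
   descent is created at position j if there was none. *)
Definition label (E : seq bool) (j : nat) : nat :=
  (if nth false E j then 0 else j) + count id (drop j.+1 E).

Definition slot (E : seq bool) (d : nat) : nat :=
  index d [seq label E j | j <- iota 0 (size E)].

Fixpoint labels (E : seq bool) (js : seq nat) : seq nat :=
  if js is j :: js' then label E j :: labels (insert_slot E j) js' else [::].

Fixpoint slots (E : seq bool) (ds : seq nat) : seq nat :=
  if ds is d :: ds' then
    slot E d :: slots (insert_slot E (slot E d)) ds'
  else [::].

Definition state_of_slots := foldl insert_slot.
Definition state_of_labels E ds := state_of_slots E (slots E ds).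

Lemma size_insert_slot E j : j < size E -> size (insert_slot E j) = (size E).+1.
Proof. by move=> lt_j; rewrite size_cat /= size_take size_drop lt_j; lia. Qed.

Lemma count_drop_nth E j :
  count id (drop j E) = nth false E j + count id (drop j.+1 E).
Proof.
by elim: E j => [|x E IH] [|j] //=; rewrite drop0.
Qed.

Lemma count_drop_le E i j : i <= j ->
  count id (drop i E) <= count id (drop j E) + (j - i).
Proof.
move=> le_ij; rewrite -(subnK le_ij) -drop_drop addnK.
rewrite -{1}(cat_take_drop (j - i) (drop i E)) count_cat addnC leq_add2l.
by rewrite (leq_trans (count_size _ _)) // size_take; case: ifP => // /negbT;
  rewrite -leqNgt.
Qed.

(** The left side is [label E i] when bit [i] is an ascent; this form also serves in
    [insert_slot_pull], where bit [i] is a descent. *)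
Lemma ltn_label_false E i j : i < j -> nth false E j = false ->
  i + count id (drop i.+1 E) < label E j.
Proof.
move=> lt_ij Ej; have := count_drop_le E lt_ij.
by rewrite (count_drop_nth _ j) /label Ej; lia.
Qed.

Lemma ltn_label_true E i j : i < j -> nth false E i -> nth false E j ->
  label E j < label E i.
Proof.
move=> lt_ij Ei Ej; rewrite /label Ei Ej !add0n.
have: count id (drop j E) <= count id (drop i.+1 E).
  rewrite -(subnK lt_ij) -drop_drop.
  by rewrite -{2}(cat_take_drop (j - i.+1) (drop i.+1 E)) count_cat leq_addl.
by rewrite count_drop_nth Ej.
Qed.

Lemma ltn_label_true_false E i j : nth false E i -> nth false E j = false ->
  label E i < label E j.
Proof.
move=> Ei Ej; rewrite /label Ei Ej.
have le0 k := count_drop_le E (leq0n k).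
have := le0 j; rewrite (count_drop_nth _ j) Ej.
rewrite drop0 -{1}(cat_take_drop i E) count_cat (count_drop_nth _ i) Ei; lia.
Qed.

(** From left to right, labels decrease along the descents and increase along the ascents, and every
    descent label is below every ascent label. Positions past the end count as ascents, whence
    injectivity on all of [nat]. *)
Lemma label_inj E : injective (label E).
Proof.
move=> i j; wlog lt_ij: i j / i < j => [IH|] eq_ij.
  by case: (ltngtP i j) => // lt; [apply: IH | symmetry; apply: IH].
case Ei: (nth false E i); case Ej: (nth false E j).
- by have := ltn_label_true lt_ij Ei Ej; rewrite eq_ij ltnn.
- by have := ltn_label_true_false Ei Ej; rewrite eq_ij ltnn.
- by have := ltn_label_true_false Ej Ei; rewrite eq_ij ltnn.
- by have := ltn_label_false lt_ij Ej; rewrite -eq_ij /label Ei ltnn.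
Qed.

Lemma label_lt E j : j < size E -> label E j < size E.
Proof.
move=> lt_j; rewrite /label.
by have := count_size id (drop j.+1 E); rewrite size_drop; case: ifP; lia.
Qed.

(** Pigeonhole: the [size E] labels are distinct and below [size E]. *)
Lemma mem_labels_of_slots E d : d < size E ->
  d \in [seq label E j | j <- iota 0 (size E)].
Proof.
have Huniq : uniq [seq label E j | j <- iota 0 (size E)].
  by rewrite map_inj_uniq ?iota_uniq //; apply: label_inj.
have sub : {subset [seq label E j | j <- iota 0 (size E)] <= iota 0 (size E)}.
  by move=> _ /mapP[j + ->]; rewrite !mem_iota !add0n => /label_lt.
have [|_ ->] := uniq_min_size Huniq sub; first by rewrite size_map.
by rewrite mem_iota.
Qed.

Lemma slot_lt E d : d < size E -> slot E d < size E.
Proof.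
by move/mem_labels_of_slots; rewrite -index_mem size_map size_iota.
Qed.

Lemma slotK E d : d < size E -> label E (slot E d) = d.
Proof.
move=> lt_d; have := nth_index 0 (mem_labels_of_slots lt_d).
rewrite (nth_map 0) ?size_iota ?slot_lt // nth_iota ?slot_lt //.
Qed.

Lemma labelK E j : j < size E -> slot E (label E j) = j.
Proof. by move=> lt_j; apply: (@label_inj E); rewrite slotK ?label_lt. Qed.

(** * Effect of insertions on a state *)

Lemma drop_insert_slot E a b : a < size E -> a.+1 < b ->
  drop b (insert_slot E a) = drop b.-1 E.
Proof.
elim: E a b => [|x E IH] [|a] [|[|b]] //= lt_a lt_b; first by rewrite drop0.
exact: IH.
Qed.

Lemma drop_insert_slot_lt E a b : a < b < size E ->
  drop a.+1 (insert_slot E b) = insert_slot (drop a.+1 E) (b - a.+1).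
Proof.
elim: E a b => [|x E IH] [|a] [|b] //= lt_ab; first by rewrite andbF in lt_ab.
  by rewrite subSS subn0 !drop0.
by rewrite subSS -IH.
Qed.

Lemma nth_insert_slot E a b : a < size E -> a < b ->
  nth false (insert_slot E a) b = (b != a.+1) && nth false E b.-1.
Proof.
elim: E a b => [|x E IH] [|a] [|[|b]] //= lt_a lt_b; first by rewrite drop0.
by rewrite IH.
Qed.

Lemma nth_insert_slot_lt E a b : a < size E -> b < a ->
  nth false (insert_slot E a) b = nth false E b.
Proof.
move=> lt_a lt_b; by rewrite nth_cat size_take lt_a lt_b nth_take.
Qed.

Lemma count_insert_slot E a : a < size E ->
  count id (insert_slot E a) = ~~ nth false E a + count id E.
Proof.
elim: E a => [|x E IH] [|a] //= lt_a; first by rewrite drop0; case: x.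
by rewrite IH //; lia.
Qed.

Lemma insert_slotC E a b : a < b < size E ->
  insert_slot (insert_slot E b) a = insert_slot (insert_slot E a) b.+1.
Proof.
elim: E a b => [|x E IH] [|a] [|b] //=; first by rewrite andbF.
  by rewrite /insert_slot /= !drop0.
by move=> ltab; rewrite /insert_slot /=; congr (_ :: _); apply: IH.
Qed.

(** * Slots for one decreasing block of labels *)

(** Slots beyond [a] drop by one because they are now filled before slot [a] has created its extra
    bit. *)
Definition merge_slot (a : nat) (js : seq nat) : seq nat :=
  [seq j.-1 | j <- js & a < j] ++ a :: [seq j <- js | j <= a].

(* Carries out first the insertion of the largest label [d], then moves it past
   the insertions that have to be made on its right. *)
Fixpoint block_slots (E : seq bool) (ds : seq nat) : seq nat :=
  if ds is d :: ds' then
    merge_slot (slot E d) (block_slots (insert_slot E (slot E d)) ds')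
  else [::].

Lemma labels_cat E js js' :
  labels E (js ++ js') = labels E js ++ labels (state_of_slots E js) js'.
Proof. by elim: js E => //= j js IH E; rewrite IH. Qed.

Lemma state_of_slots_cat E js js' :
  state_of_slots E (js ++ js') = state_of_slots (state_of_slots E js) js'.
Proof. exact: foldl_cat. Qed.

(* The labels of [bs] being at most that of [a], all insertions [bs] take place
   at descents, so they commute with the insertion in slot [a]. *)
Lemma insert_slot_pull E a bs : a < size E ->
    all (fun b => a < b) bs ->
    all (fun b => b <= size E) bs ->
    all (fun d => d <= label E a) (labels (insert_slot E a) bs) ->
  let bs' := map predn bs in
  [/\ labels E bs' = labels (insert_slot E a) bs,
      label (state_of_slots E bs') a = label E a &
      insert_slot (state_of_slots E bs') a =
      state_of_slots (insert_slot E a) bs].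
Proof.
elim: bs E => //= b bs IH E lt_a /andP[lt_ab gt_a] /andP[le_b le_bs]
  /andP[le_lab le_labs].
set E1 := insert_slot E a in le_lab le_labs *.
(* An ascent of [E1] to the right of [a] would have a label larger than [label E a]. *)
have E1b : nth false E1 b.
  apply: contraLR le_lab => /negbTE E1b; rewrite -ltnNge.
  apply: leq_trans (ltn_label_false lt_ab E1b); rewrite ltnS.
  have -> : drop a.+1 E1 = false :: drop a.+1 E.
    rewrite /E1 /insert_slot drop_cat size_take lt_a ltnNge leqnSn /=.
    by rewrite subSn // subnn.
  by rewrite /label /=; case: ifP; lia.
(* Bit [a.+1] of [E1] is the ascent just created, so [b] lies beyond it and comes from the descent
   [b.-1] of [E]. *)
have [neq_b Eb] : b != a.+1 /\ nth false E b.-1.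
  by apply/andP; rewrite -nth_insert_slot.
have lt_a_b1 : a < b.-1 by lia.
have lt_b1 : b.-1 < size E by lia.
have E1E : insert_slot (insert_slot E b.-1) a = insert_slot E1 b.
  by rewrite insert_slotC ?lt_a_b1 // prednK //; lia.
have lab_a : label (insert_slot E b.-1) a = label E a.
  rewrite /label nth_insert_slot_lt // drop_insert_slot_lt ?lt_a_b1 //.
  rewrite count_insert_slot ?size_drop; last by lia.
  by rewrite nth_drop subnKC // Eb.
have lab_b : label E b.-1 = label E1 b.
  rewrite /label E1b Eb prednK; last by lia.
  by rewrite drop_insert_slot //; lia.
have [||||-> -> ->] := IH (insert_slot E b.-1).
- by rewrite size_insert_slot //; lia.
- by [].
- by rewrite size_insert_slot //; apply: sub_all le_bs => x; lia.
- by rewrite E1E lab_a.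
by rewrite lab_b lab_a E1E.
Qed.

Lemma sorted_geq_filter a js : sorted geq js ->
  js = [seq j <- js | a < j] ++ [seq j <- js | j <= a].
Proof.
elim: js => //= j js IH js_sorted.
have {}IH := IH (path_sorted js_sorted).
case: ltnP => [lt_aj|le_ja] /=; first by rewrite -IH.
have le_js : all (fun x => x <= a) js.
  by apply: sub_all (order_path_min geq_trans js_sorted) => x /= le_xj;
    apply: leq_trans le_ja.
rewrite (all_filterP le_js).
suff -> : [seq j0 <- js | a < j0] = [::] by [].
apply/eqP; rewrite -[_ == _]negbK -has_filter; apply/hasPn => x /(allP le_js).
by rewrite -leqNgt.
Qed.

Lemma size_block_slots E ds : size (block_slots E ds) = size ds.
Proof.
elim: ds E => //= d ds IH E.
rewrite /merge_slot size_cat size_map /= !size_filter addnS.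
rewrite -(IH (insert_slot E (slot E d))).
rewrite -(count_predC (fun j => slot E d < j)); congr (_ + _).+1.
by apply: eq_count => x /=; rewrite -leqNgt.
Qed.

(** Since [d] is the largest label, every label of the tail is at most [label E a], so
    [insert_slot_pull] lets the tail slots right of [a] be filled first. No label changes value;
    only [d] moves among them. *)
Lemma block_slotsP E ds : sorted geq ds -> all (gtn (size E)) ds ->
  [/\ sorted geq (block_slots E ds),
      all (gtn (size E)) (block_slots E ds),
      perm_eq (labels E (block_slots E ds)) ds &
      state_of_slots E (block_slots E ds) = state_of_labels E ds].
Proof.
elim: ds E => //= d ds IH E ds_sorted /andP[lt_d lt_ds].
have lt_a := slot_lt lt_d; have lab_a := slotK lt_d.
set a := slot E d in lt_a lab_a *; set E1 := insert_slot E a.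
have szE1 : size E1 = (size E).+1 by rewrite size_insert_slot.
have [||] := IH E1; first exact: path_sorted ds_sorted.
  by rewrite szE1; apply: sub_all lt_ds => x /=; lia.
set js := block_slots E1 ds => js_sorted lt_js js_perm js_state.
have js_cat := sorted_geq_filter a js_sorted.
rewrite /merge_slot; set bs := filter _ js in js_cat *;
  set rs := filter _ js in js_cat *.
have gt_bs : all (fun b => a < b) bs by apply: filter_all.
have le_rs : all (fun b => b <= a) rs by apply: filter_all.
have lt_bs : all (fun b => b <= size E) bs.
  by move: lt_js; rewrite js_cat all_cat szE1 => /andP[].
have lab_bs : all (fun x => x <= label E a) (labels E1 bs).
  have : all (fun x => x <= d) (labels E1 js).
    rewrite (perm_all _ js_perm); exact: order_path_min geq_trans ds_sorted.
  by rewrite js_cat labels_cat all_cat lab_a => /andP[].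
have [labs_bs lab_a' st_bs] := insert_slot_pull lt_a gt_bs lt_bs lab_bs.
split.
- move: js_sorted; rewrite js_cat !(sorted_pairwise geq_trans) !pairwise_cat
    pairwise_map /=.
  case/and3P=> _ bs_s rs_s; rewrite rs_s !andbT; apply/and3P; split.
  (* Slots beyond [a] stay at least [a] after the decrement, so [a] fits between the two parts. *)
  + rewrite allrel_consr all_map; apply/andP; split;
      first by apply: sub_all gt_bs => x /=; lia.
    apply/allrelP => _ y /mapP[x xbs ->] yrs /=.
    by have := allP gt_bs _ xbs; have := allP le_rs _ yrs; move=> /=; lia.
  + by apply: sub_pairwise bs_s => x y /=; lia.
  + exact: le_rs.
- rewrite all_cat all_map /= lt_a /=; apply/andP; split.
    by apply/allP => x xbs /=; have := allP lt_bs _ xbs;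
      have := allP gt_bs _ xbs; lia.
  by apply: sub_all le_rs => x /=; lia.
- rewrite labels_cat /= labs_bs st_bs lab_a' lab_a perm_catC /= perm_cons.
  rewrite perm_catC -labels_cat -js_cat; exact: js_perm.
- rewrite state_of_slots_cat /= -/(state_of_slots _ _) st_bs
    -state_of_slots_cat -js_cat js_state.
  by rewrite /state_of_labels /=.
Qed.

(** * Sequences of decreasing blocks *)

Lemma size_state_of_slots E js : all (gtn (size E)) js ->
  size (state_of_slots E js) = size E + size js.
Proof.
elim: js E => [|j js IH] E /=; first by rewrite addn0.
case/andP=> lt_j lt_js; rewrite IH size_insert_slot //;
  first by rewrite addSnnS.
by apply: sub_all lt_js => x /=; lia.
Qed.

Lemma slots_cat E ds ds' :
  slots E (ds ++ ds') = slots E ds ++ slots (state_of_labels E ds) ds'.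
Proof. by elim: ds E => //= d ds IH E; rewrite IH. Qed.

Lemma state_of_labels_cat E ds ds' :
  state_of_labels E (ds ++ ds') = state_of_labels (state_of_labels E ds) ds'.
Proof. by rewrite /state_of_labels slots_cat state_of_slots_cat. Qed.

Fixpoint blockwise_slots (E : seq bool) (dss : seq (seq nat)) : seq (seq nat) :=
  if dss is ds :: dss' then
    block_slots E ds :: blockwise_slots (state_of_labels E ds) dss'
  else [::].

(** [N] counts the slots available when a block starts; by [bounded_sorted] a decreasing block may
    be tested against this one bound. *)
Fixpoint decreasing_blocks (N : nat) (dss : seq (seq nat)) : bool :=
  if dss is ds :: dss' then
    [&& sorted geq ds, all (gtn N) ds & decreasing_blocks (N + size ds) dss']
  else true.

(** The blocks can be treated one after the other because [block_slots] reaches the same state as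
    the labels do, so the next block starts from a common state. *)
Lemma blockwise_slotsP E dss : decreasing_blocks (size E) dss ->
  [/\ shape (blockwise_slots E dss) = shape dss,
      decreasing_blocks (size E) (blockwise_slots E dss),
      perm_eq (labels E (flatten (blockwise_slots E dss))) (flatten dss) &
      state_of_slots E (flatten (blockwise_slots E dss)) =
        state_of_labels E (flatten dss)].
Proof.
elim: dss E => //= ds dss IH E /and3P[ds_s lt_ds dss_b].
have [js_s lt_js js_perm js_st] := block_slotsP ds_s lt_ds.
have sz := size_state_of_slots lt_js.
rewrite js_st size_block_slots in sz.
have [|sh jss_b jss_perm jss_st] := IH (state_of_labels E ds);
  first by rewrite sz.
rewrite size_block_slots sh js_s lt_js -sz jss_b; split=> //.
  by rewrite labels_cat js_st perm_cat.
by rewrite state_of_slots_cat state_of_labels_cat js_st.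
Qed.

(** A block is recovered from its image as the decreasing rearrangement of the labels of that
    image. *)
Lemma block_slots_inj E ds ds' : sorted geq ds -> all (gtn (size E)) ds ->
  sorted geq ds' -> all (gtn (size E)) ds' ->
    block_slots E ds = block_slots E ds' -> ds = ds'.
Proof.
move=> s1 l1 s2 l2 eq_slots.
have [_ _ p1 _] := block_slotsP s1 l1; have [_ _ p2 _] := block_slotsP s2 l2.
apply: (sorted_eq geq_trans) => //.
  by move=> x y /= /andP[le1 le2]; apply/eqP; rewrite eqn_leq le1 le2.
by rewrite -(permPl p1) eq_slots.
Qed.

Lemma blockwise_slots_inj E dss dss' : decreasing_blocks (size E) dss ->
  decreasing_blocks (size E) dss' ->
  blockwise_slots E dss = blockwise_slots E dss' -> dss = dss'.
Proof.
elim: dss E dss' => [|ds dss IH] E [|ds' dss'] //=.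
move=> /and3P[s1 l1 b1] /and3P[s2 l2 b2] [eq1 eq2].
have eq_ds := block_slots_inj s1 l1 s2 l2 eq1; rewrite -eq_ds in eq2 b2 *.
congr (_ :: _); apply: IH eq2.
  have [_ lt_js _ st] := block_slotsP s1 l1.
  by rewrite -st size_state_of_slots // size_block_slots.
have [_ lt_js _ st] := block_slotsP s1 l1.
by rewrite -st size_state_of_slots // size_block_slots.
Qed.

(* [d] is subdiagonal iff [bounded 1 (rev d)]. *)
Fixpoint bounded (N : nat) (r : seq nat) : bool :=
  if r is j :: r' then (j < N) && bounded N.+1 r' else true.

Lemma bounded_cat N r r' :
  bounded N (r ++ r') = bounded N r && bounded (N + size r) r'.
Proof.
elim: r N => [|j r IH] N /=; first by rewrite addn0.
by rewrite IH addSnnS andbA.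
Qed.

(** The bounds grow along the word while the letters decrease, so the first letter decides. *)
Lemma bounded_sorted N r : sorted geq r -> bounded N r = all (gtn N) r.
Proof.
case: r => //= j r r_s; case: ltnP => //= lt_j.
have lt_r : all (gtn N) r.
  by apply: sub_all (order_path_min geq_trans r_s) => x /= /leq_ltn_trans->.
rewrite lt_r; elim: r N lt_r {r_s lt_j} => //= i r IH N /andP[lt_i lt_r].
by rewrite (ltn_trans lt_i) //= IH //; apply: sub_all lt_r => x /=; lia.
Qed.

Lemma decreasing_blocksE N dss :
  decreasing_blocks N dss = bounded N (flatten dss) && all (sorted geq) dss.
Proof.
elim: dss N => //= ds dss IH N; rewrite bounded_cat IH.
case ds_s: (sorted geq ds); last by rewrite /= andbF.
by rewrite (bounded_sorted N ds_s) /= !andbA.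
Qed.

(** * Words decreasing at prescribed positions *)

Definition weakly_decreasing_at (c : pred nat) (r : seq nat) : Prop :=
  forall k, k.+1 < size r -> c k -> nth 0 r k.+1 <= nth 0 r k.

Lemma weakly_decreasing_shape (c : pred nat) n :
  exists2 sh, sumn sh = n & forall r, size r = n ->
    weakly_decreasing_at c r <-> all (sorted geq) (reshape sh r).
Proof.
(* Nonempty blocks are kept in the induction: the first block of the tail then contains the first
   letter of the tail, and is prolonged by the new letter if [c 0] holds, preceded by a singleton
   block otherwise. *)
suff [sh [sum_sh _ shP]] : exists sh, [/\ sumn sh = n, all (leq 1) sh &
    forall r, size r = n ->
    weakly_decreasing_at c r <-> all (sorted geq) (reshape sh r)].
  by exists sh.
elim: n c => [|n IH] c; first by exists [::]; split=> // r /size0nil->; split.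
have [sh [sum_sh pos_sh shP]] := IH (c \o S).
have decS a b r : weakly_decreasing_at c [:: a, b & r] <->
    (c 0 -> b <= a) /\ weakly_decreasing_at (c \o S) (b :: r).
  split=> [dec|[dec0 decS] [|k]] //; last exact: decS.
  split; first by move=> c0; apply: (dec 0).
  by move=> k lt_k ck; apply: (dec k.+1).
case: sh sum_sh pos_sh shP => [|[|s] sh] //= sum_sh pos_sh shP.
  by exists [:: 1]; rewrite -sum_sh; split=> // -[|a []] //= _; split=> // _ [].
case c0: (c 0).
  exists (s.+2 :: sh); split; first by rewrite /= -sum_sh.
    by [].
  move=> [|a [|b r]] //= [sz_r]; first by rewrite -sz_r in sum_sh.
  rewrite decS c0 (shP (b :: r) sz_r) /=.
  by split=> [[-> //]|/andP[/andP[-> ->] ->]].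
exists [:: 1, s.+1 & sh]; split; first by rewrite /= -sum_sh.
  by [].
move=> [|a [|b r]] //= [sz_r]; first by rewrite -sz_r in sum_sh.
rewrite decS c0 (shP (b :: r) sz_r) /=.
by split=> [[] //|].
Qed.

(** Block construction on flat words, from the state [E] of the empty word. For the [c] of
    [Iligne_subset], [D] describes the words [rev (Ic s)] with [Iligne s] contained in [A]. *)
Lemma rearrangement_exists (c : pred nat) n :
  let E := [:: true] in
  let D r := [/\ size r = n, bounded 1 r & weakly_decreasing_at c r] in
  exists g : seq nat -> seq nat,
  [/\ forall r, D r -> D (g r),
      forall r r', D r -> D r' -> g r = g r' -> r = r',
      forall r, D r -> perm_eq (labels E (g r)) r &
      forall r, D r -> state_of_slots E (g r) = state_of_labels E r].
Proof.
move=> E D; have [sh sum_sh shP] := weakly_decreasing_shape c n.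
have DP r : D r -> decreasing_blocks (size E) (reshape sh r) /\ flatten
  (reshape sh r) = r.
  case=> sz_r bnd_r /(shP _ sz_r) dec_r.
  have flatK : flatten (reshape sh r) = r by rewrite reshapeKr // sum_sh sz_r.
  by rewrite decreasing_blocksE flatK bnd_r.
have shapeE r : D r -> shape (reshape sh r) = sh.
  by case=> sz_r _ _; rewrite reshapeKl // sum_sh sz_r.
exists (fun r => flatten (blockwise_slots E (reshape sh r))); split=> r.
- move=> Dr; have [b_r flatK] := DP r Dr.
  have [sh_r b_g _ _] := blockwise_slotsP b_r; rewrite shapeE // in sh_r.
  have szg : size (flatten (blockwise_slots E (reshape sh r))) =
    n by rewrite size_flatten sh_r.
  move: b_g; rewrite decreasing_blocksE => /andP[bnd_g s_g]; split=> //.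
  by apply/(shP _ szg); rewrite -{1}sh_r flattenK.
- move=> r' Dr Dr' eq_g; have [b_r flatK] := DP r Dr;
    have [b_r' flatK'] := DP r' Dr'.
  rewrite -flatK -flatK'; congr flatten; apply: (@blockwise_slots_inj E) => //.
  have [sh_r _ _ _] := blockwise_slotsP b_r;
    have [sh_r' _ _ _] := blockwise_slotsP b_r'.
  by rewrite -[LHS]flattenK -[RHS]flattenK eq_g sh_r sh_r' !shapeE.
- move=> Dr; have [b_r flatK] := DP r Dr.
  by have [_ _] := blockwise_slotsP b_r; rewrite flatK.
- move=> Dr; have [b_r flatK] := DP r Dr.
  by have [_ _ _] := blockwise_slotsP b_r; rewrite flatK.
Qed.

(** * State and major index after inserting a smallest letter *)

Fixpoint descents (a : nat) (u : seq nat) : seq bool :=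
  if u is b :: u' then (b < a) :: descents b u' else [:: false].

Definition word_state (u : seq nat) : seq bool :=
  true :: (if u is a :: u' then descents a u' else [::]).

Definition insert_at (x j : nat) (u : seq nat) := take j u ++ x :: drop j u.

Lemma word_state_insert_at x j u : all (ltn x) u -> j <= size u ->
  word_state (insert_at x j u) = insert_slot (word_state u) j.
Proof.
case: j u => [|j] [|a u] //=.
  rewrite /word_state /insert_at /insert_slot /= drop0 => /andP[lt_xa _] _.
  by rewrite ltnNge (ltnW lt_xa).
rewrite ltnS /word_state /insert_at /insert_slot /= => /andP[lt_xa lt_u] le_j.
congr (_ :: _).
elim: j u a lt_xa lt_u le_j => [|j IH] [|b u] a //= lt_xa.
- by rewrite lt_xa.
- by case/andP=> lt_xb _ _; rewrite lt_xa ltnNge (ltnW lt_xb) drop0.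
- by case/andP=> lt_xb lt_u le_j; rewrite IH.
Qed.

Lemma maj_fromSE k a u :
  maj_from k.+1 (a :: u) = maj_from k (a :: u) + count id (descents a u).
Proof.
elim: u k a => //= b u IH k a.
by have /= -> := IH k.+1 b; case: ltnP => _; lia.
Qed.

(** The letter in front of [x] has position [k + j]: a descent appears there unless there was one
    already, and the descents further right move by one, as counted in [maj_fromSE]. *)
Lemma maj_from_insert_at k a x j u :
    x < a -> all (ltn x) u -> j <= size u ->
  maj_from k (a :: insert_at x j u) =
  maj_from k (a :: u) + (if nth false (descents a u) j then 0 else k + j)
    + count id (drop j.+1 (descents a u)).
Proof.
elim: j u k a => [|j IH] [|b u] k a //= lt_xa.
- by rewrite lt_xa; lia.
- case/andP=> lt_xb _ _; rewrite lt_xa drop0 ltnNge (ltnW lt_xb) /= !add0n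
    addn0.
  have /= -> := maj_fromSE k.+1 b u.
  by case: ltnP => _; lia.
- case/andP=> lt_xb lt_u le_j.
  have /= := IH u k.+1 b lt_xb lt_u le_j; rewrite /insert_at /= => ->.
  by case: nth => /=; lia.
Qed.

Lemma maj_insert_at x j u : all (ltn x) u -> j <= size u ->
  maj (insert_at x j u) = maj u + label (word_state u) j.
Proof.
rewrite !majE; case: j u => [|j] [|a u] //.
  rewrite /word_state /insert_at /label /= drop0 => /andP[lt_xa _] _.
  rewrite ltnNge (ltnW lt_xa) !add0n.
  exact: (maj_fromSE 1).
case/andP=> lt_xa lt_u le_j.
have -> : insert_at x j.+1 (a :: u) = a :: insert_at x j u by [].
rewrite (maj_from_insert_at 1 lt_xa lt_u le_j).
by rewrite /word_state /label /= add1n addnA.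
Qed.

Lemma nth_word_state u i : 0 < i < size u ->
  nth false (word_state u) i = (nth 0 u i < nth 0 u i.-1).
Proof.
rewrite /word_state; case: u i => [|a u] [|i] //=.
by elim: u a i => [|b u IH] a [|i] //=; apply: IH.
Qed.

(** * Codes of a permutation as insertion data *)

Lemma size_word_of n (s : 'S_n) : size (word_of s) = n.
Proof. by rewrite size_map size_enum_ord. Qed.

Lemma nth_word_of n (s : 'S_n) (i : 'I_n) : nth 0 (word_of s) i = (s i).+1.
Proof. by rewrite (nth_map i) ?nth_ord_enum // size_enum_ord. Qed.

Lemma uniq_word_of n (s : 'S_n) : uniq (word_of s).
Proof. by rewrite map_inj_uniq ?enum_uniq // => i j [/val_inj/perm_inj]. Qed.

Lemma mem_word_of n (s : 'S_n) x : (x \in word_of s) = (0 < x <= n).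
Proof.
apply/mapP/idP => [[i _ ->] | ]; first by rewrite ltn_ord.
case: x => //= x lt_x; exists (s^-1 (Ordinal lt_x))%g;
  first by rewrite mem_enum.
by rewrite permKV.
Qed.

Lemma word_of_inj n : injective (@word_of n).
Proof.
move=> s t eq_w; apply/permP => i; apply/val_inj/succn_inj.
by rewrite -!nth_word_of eq_w.
Qed.

Lemma size_Lc n (s : 'S_n) : size (Lc s) = n.
Proof. by rewrite size_map size_enum_ord. Qed.

Lemma nth_Lc n (s : 'S_n) (i : 'I_n) :
  nth 0 (Lc s) i = #|[set j : 'I_n | (i < j) && (s j < s i)]|.
Proof. by rewrite (nth_map i) ?nth_ord_enum // size_enum_ord. Qed.

Lemma size_Mc n (s : 'S_n) : size (Mc s) = n.
Proof. by rewrite size_map size_iota. Qed.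

(** Both sides count the letters larger than [i.+1] standing to its left, the first by position and
    the second by value; [s] carries one to the other. *)
Lemma index_erase_below n (s : 'S_n) (i : 'I_n) :
  index i.+1 (erase_below i.+1 (word_of s)) = nth 0 (Ic s) i.
Proof.
rewrite nth_Lc; set p := (s^-1 i)%g.
have sp : s p = i by rewrite permKV.
have wp : nth 0 (word_of s) p = i.+1 by rewrite nth_word_of sp.
have lt_p : p < size (word_of s) by rewrite size_word_of.
rewrite -{1}(cat_take_drop p (word_of s)) (drop_nth 0) // wp /erase_below.
rewrite filter_cat /= leqnn index_cat /= eqxx addn0 mem_filter.
have := uniq_word_of s; rewrite -{1}(cat_take_drop p (word_of s)).
rewrite (drop_nth 0) // wp cat_uniq /= negb_or => /and3P[_
  /andP[/negbTE-> _] _].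
rewrite andbF size_filter -sum1_count (big_nth 0) size_take lt_p big_mkord.
rewrite (big_ord_widen_cond n (fun k => i.+1 <= nth 0 (take p (word_of s)) k)
  (fun=> 1)); last first.
  exact: ltnW.
rewrite sum1_card -(card_imset _ (@perm_inj _ s)); apply: eq_card => j.
rewrite -[j in LHS](permKV s) mem_imset; last exact: perm_inj.
rewrite inE -topredE /= -/p; set k := (s^-1 j)%g;
  have sk : s k = j by rewrite permKV.
case: (ltnP k p) => [lt_k|]; last by rewrite !andbF.
rewrite nth_take // nth_word_of sk !andbT ltnS leq_eqVlt;
  apply: orb_idl => /eqP/val_inj eq_ij.
by rewrite /k -eq_ij ltnn in lt_k.
Qed.

Lemma erase_belowS n (s : 'S_n) (i : 'I_n) :
  erase_below i.+1 (word_of s) =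
  insert_at i.+1 (nth 0 (Ic s) i) (erase_below i.+2 (word_of s)).
Proof.
rewrite -index_erase_below; set v := erase_below i.+1 _.
have vi : i.+1 \in v by rewrite mem_filter mem_word_of leqnn /= ltn_ord.
have -> : erase_below i.+2 (word_of s) = rem i.+1 v.
  rewrite rem_filter; last exact/filter_uniq/uniq_word_of.
  rewrite -filter_predI; apply: eq_filter => x /=.
  by rewrite [LHS]ltn_neqAle eq_sym.
rewrite remE /insert_at; set p := index _ _.
have lt_p : p < size v by rewrite index_mem.
rewrite take_size_cat ?drop_size_cat ?size_takel // ?(ltnW lt_p) //.
by rewrite -{1}(cat_take_drop p v) (drop_nth 0) // nth_index.
Qed.

Lemma nth_Ic_le n (s : 'S_n) (i : 'I_n) :
  nth 0 (Ic s) i <= size (erase_below i.+2 (word_of s)).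
Proof.
have := index_erase_below s i; rewrite erase_belowS => idx.
have : i.+1 \in insert_at i.+1 (nth 0 (Ic s) i) (erase_below i.+2 (word_of s)).
  by rewrite mem_cat mem_head orbT.
rewrite -index_mem idx size_cat /= size_take size_drop; case: ifP; lia.
Qed.

Lemma erase_below_max n (s : 'S_n) : erase_below n.+1 (word_of s) = [::].
Proof.
apply/eqP; rewrite -[_ == _]negbK -has_filter; apply/hasPn => x.
by rewrite mem_word_of -leqNgt => /andP[].
Qed.

Lemma erase_below1 n (s : 'S_n) : erase_below 1 (word_of s) = word_of s.
Proof. by apply/all_filterP/allP => x; rewrite mem_word_of => /andP[]. Qed.

Lemma ord_down_ind n (P : nat -> Prop) :
  P n -> (forall i : 'I_n, P i.+1 -> P i) -> P 0.
Proof.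
move=> Pn PS; suff H k : k <= n -> P (n - k) by rewrite -(subnn n); apply: H.
elim: k => [|k IH] le_k; first by rewrite subn0.
have lt_i : n - k.+1 < n by lia.
by apply: (PS (Ordinal lt_i)); rewrite /= -subSn // subSS; apply: IH;
  apply: ltnW.
Qed.

Lemma Ic_inj n : injective (@Ic n).
Proof.
move=> s t eq_I; apply: word_of_inj.
rewrite -(erase_below1 s) -(erase_below1 t).
pose P k := erase_below k.+1 (word_of s) = erase_below k.+1 (word_of t).
apply: (@ord_down_ind n P) => [|i]; rewrite /P;
  first by rewrite !erase_below_max.
by rewrite !erase_belowS eq_I => ->.
Qed.

Lemma Ic_state n (s : 'S_n) (r := rev (Ic s)) :
  [/\ bounded 1 r, state_of_slots [:: true] r = word_state (word_of s) &
      labels [:: true] r = rev (Mc s)].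
Proof.
(* The codes from index [k] on describe the insertion of the letters above [k]. The equality of
   sizes turns [nth_Ic_le] into the bound on the next slot. *)
pose P k := let r := rev (drop k (Ic s)) in
  let w := erase_below k.+1 (word_of s) in
  [/\ bounded 1 r, size r = size w, state_of_slots [:: true] r = word_state w &
      labels [:: true] r = rev (drop k (Mc s))].
suff: P 0 by rewrite /P !drop0 erase_below1 => -[].
apply: (@ord_down_ind n P) => [|i]; rewrite /P.
  by rewrite !drop_oversize ?size_Lc ?size_Mc // erase_below_max.
have nth_M : nth 0 (Mc s) i = maj (erase_below i.+1 (word_of s))
                              - maj (erase_below i.+2 (word_of s)).
  by rewrite (nth_map 0) ?size_iota // nth_iota.
have le_j := nth_Ic_le s i.
have gt_u : all (ltn i.+1) (erase_below i.+2 (word_of s)) by apply: filter_all.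
rewrite [drop i (Ic s)](drop_nth 0) ?size_Lc //.
rewrite [drop i (Mc s)](drop_nth 0) ?size_Mc // nth_M erase_belowS !rev_cons.
set u := erase_below _ _ in gt_u le_j *; set j := nth 0 _ _ in le_j *.
move=> [bnd sz st lab]; rewrite -!cats1 labels_cat state_of_slots_cat
  bounded_cat.
rewrite bnd sz st lab /= word_state_insert_at // maj_insert_at //
  addKn ltnS le_j.
by split=> //; rewrite !size_cat sz /= size_takel // size_drop; lia.
Qed.

(** * Ligne of route read on the state and on the code *)

Lemma LigneE n (s : 'S_n) :
  Ligne s = [set i : 'I_n | (0 < i) && nth false (word_state (word_of s)) i].
Proof.
apply/setP => i; rewrite !inE; case: (posnP i) => //= i_gt0.
by rewrite nth_word_state // i_gt0 size_word_of ltn_ord.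
Qed.

(** At a descent, the set counted at [i] is contained in the one counted at [i.-1], which also
    contains [i]; at an ascent the inclusion is reversed. *)
Lemma Ligne_Lc n (s : 'S_n) (i : 'I_n) :
  (i \in Ligne s) = (0 < i) && (nth 0 (Lc s) i < nth 0 (Lc s) i.-1).
Proof.
rewrite inE; case: (posnP i) => //= i_gt0.
have lt_i' : i.-1 < n by apply: leq_ltn_trans (leq_pred i) _.
rewrite -[i.-1]/(val (Ordinal lt_i')); set i' := Ordinal lt_i'.
rewrite !nth_word_of !nth_Lc ltnS; case: ltnP => [lt_s|le_s]; symmetry.
  apply/proper_card/properP; split.
    by apply/subsetP => j; rewrite !inE /= => /andP[lt_ij lt_sj]; lia.
  by exists i; rewrite !inE ?ltnn //= lt_s; lia.
apply/negbTE; rewrite -leqNgt; apply/subset_leq_card/subsetP => j.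
rewrite !inE /= => /andP[lt_ij lt_sj]; rewrite (leq_trans lt_sj le_s) andbT.
rewrite ltn_neqAle; apply/andP; split; last by lia.
by apply: contraTneq lt_sj => /val_inj <-; rewrite -leqNgt.
Qed.

(** Letters [k] and [k.+1] of the reversed code are those of [Ic s] at indices [i] and [i.-1] with
    [i = n - k.+1], hence the equation in [c]. *)
Lemma Iligne_subset n (s : 'S_n) (A : {set 'I_n}) :
  let c k := [forall i : 'I_n, (i + k.+1 == n) ==> (i \notin A)] in
  Iligne s \subset A <-> weakly_decreasing_at c (rev (Ic s)).
Proof.
move=> c; split=> [/subsetP sub k|dec].
  rewrite size_rev size_Lc => lt_k /forallP ck.
  have lt_i : n - k.+1 < n by lia.
  have := ck (Ordinal lt_i); rewrite /= subnK ?eqxx //=; last by lia.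
  move=> /(contra (sub _)); rewrite Ligne_Lc /= subn_gt0 lt_k /= -leqNgt.
  by rewrite !nth_rev ?size_Lc -?subnS //; lia.
apply/subsetP => i; apply: contraTT => iA.
rewrite Ligne_Lc negb_and; case: (posnP i) => //= i_gt0; rewrite -leqNgt.
have lt_i := ltn_ord i.
have := dec (n - i.+1); rewrite size_rev size_Lc !nth_rev ?size_Lc; try lia.
have -> : n - (n - i.+1).+2 = i.-1 by lia.
have -> : n - (n - i.+1).+1 = i by lia.
apply; first by lia.
apply/forallP => i'; apply/implyP => /eqP eq_i'.
by suff -> : i' = i by []; apply: val_inj => /=; lia.
Qed.

(** * Bijectivity of the codes *)

(** The head of [J] is the slot of the smallest letter [i.+1], inserted last; the offset [i] lets
    the induction run on the tail. *)
Lemma word_exists (i : nat) (J : seq nat) : bounded 1 (rev J) ->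
  exists2 w, perm_eq w (iota i.+1 (size J)) &
    forall k, k < size J ->
      index (i + k).+1 (erase_below (i + k).+1 w) = nth 0 J k.
Proof.
elim: J i => [|j J IH] i; first by exists [::].
rewrite rev_cons -cats1 bounded_cat size_rev /= andbT => /andP[/IH bnd lt_j].
have [w w_perm w_idx] := bnd i.+1.
have sz_w : size w = size J by rewrite (perm_size w_perm) size_iota.
have mem_w x : (x \in w) -> i.+1 < x.
  by rewrite (perm_mem w_perm) mem_iota => /andP[].
exists (insert_at i.+1 j w) => [|[|k] lt_k].
- by rewrite /insert_at perm_catC /= perm_cons perm_catC cat_take_drop.
- have -> : erase_below (i + 0).+1 (insert_at i.+1 j w) = insert_at i.+1 j w.
    apply/all_filterP/allP => x;
      rewrite addn0 mem_cat inE orbCA -mem_cat cat_take_drop.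
    by case/predU1P=> [->//|/mem_w/ltnW].
  rewrite addn0 index_cat /= eqxx addn0 size_takel ?sz_w //.
  by case: ifP => // /mem_take/mem_w; rewrite ltnn.
- rewrite [RHS]/= -(w_idx k) // addnS -addSn; congr index.
  rewrite /erase_below filter_cat /= -[in RHS](cat_take_drop j w) filter_cat.
  by rewrite ifN // -ltnNge; lia.
Qed.

Lemma Ic_surj n J : size J = n -> bounded 1 (rev J) ->
  exists s : 'S_n, Ic s = J.
Proof.
move=> sz_J /(word_exists 0)[w]; rewrite sz_J => w_perm w_idx.
have sz_w : size w = n by rewrite (perm_size w_perm) size_iota.
have w_uniq : uniq w by rewrite (perm_uniq w_perm) iota_uniq.
(* The default [i] is never taken: the letters of [w] lie between 1 and [n]. *)
pose f (i : 'I_n) : 'I_n := insubd i (nth 0 w i).-1.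
have fE (i : 'I_n) : (f i).+1 = nth 0 w i.
  have : nth 0 w i \in w by rewrite mem_nth ?sz_w.
  rewrite (perm_mem w_perm) mem_iota add1n ltnS => /andP[gt0 le_n].
  by rewrite val_insubd prednK // le_n prednK.
have f_inj : injective f.
  move=> i j eq_f; apply/ord_inj/eqP.
  by rewrite -(nth_uniq 0 _ _ w_uniq) ?sz_w // -!fE eq_f.
exists (perm f_inj).
have -> : Ic (perm f_inj) = J; last by [].
apply: (@eq_from_nth _ 0) => [|k]; rewrite size_Lc ?sz_J // => lt_k.
have := index_erase_below (perm f_inj) (Ordinal lt_k); rewrite /= => <-.
rewrite -w_idx //; congr (index _ (erase_below _ _)).
apply: (@eq_from_nth _ 0) => [|i]; rewrite size_word_of ?sz_w // => lt_i.
by have := nth_word_of (perm f_inj) (Ordinal lt_i); rewrite /= permE fE.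
Qed.

Lemma labels_slots E ds : bounded (size E) ds -> labels E (slots E ds) = ds.
Proof.
elim: ds E => //= d ds IH E /andP[lt_d bnd].
by rewrite slotK // IH // size_insert_slot // slot_lt.
Qed.

Lemma slots_labels E js : bounded (size E) js -> slots E (labels E js) = js.
Proof.
elim: js E => //= j js IH E /andP[lt_j bnd].
by rewrite labelK // IH // size_insert_slot.
Qed.

Lemma bounded_slots E ds : bounded (size E) ds -> bounded (size E) (slots E ds).
Proof.
elim: ds E => //= d ds IH E /andP[lt_d bnd].
have lt_s := slot_lt lt_d; rewrite lt_s /=.
by have := IH (insert_slot E (slot E d)); rewrite size_insert_slot //; apply.
Qed.

Lemma size_slots E ds : size (slots E ds) = size ds.
Proof. by elim: ds E => //= d ds IH E; rewrite IH. Qed.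

Lemma Mc_inj n : injective (@Mc n).
Proof.
move=> s t eq_M; apply/Ic_inj/(can_inj revK).
have [bs _ ls] := Ic_state s; have [bt _ lt] := Ic_state t.
by rewrite -(@slots_labels [:: true] _ bs) -(@slots_labels [:: true] _ bt) ls
  lt eq_M.
Qed.

Lemma El_Mc n (s : 'S_n) : El n (Mc s) = Ligne s.
Proof.
rewrite /El; case: pickP => [t /eqP/Mc_inj->|/(_ s)] //.
by rewrite eqxx.
Qed.

(** The labels are converted to slots, which [Ic_surj] realizes. The second conclusion gives access
    to [El n d] without knowing the preimage. *)
Lemma Mc_surj n d : size d = n -> bounded 1 (rev d) ->
  exists2 s : 'S_n, Mc s = d &
    word_state (word_of s) = state_of_labels [:: true] (rev d).
Proof.
move=> sz_d bnd; pose J := slots [:: true] (rev d).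
have [||s sJ] := @Ic_surj n (rev J).
- by rewrite size_rev size_slots size_rev.
- by rewrite revK; apply: (@bounded_slots [:: true]).
have [_ st lab] := Ic_state s; exists s.
  by apply: (can_inj revK); rewrite -lab sJ revK labels_slots.
by rewrite -st sJ revK.
Qed.

Lemma Ligne_state n (s t : 'S_n) :
  word_state (word_of s) = word_state (word_of t) -> Ligne s = Ligne t.
Proof. by move=> eq_st; rewrite !LigneE eq_st. Qed.

(** * Counting *)

(** By finiteness [g] permutes [X], so it maps each fibre of [f2] in [X] onto that of [f1]. *)
Lemma card_inj_transfer (T : finType) (R : eqType) (X : {set T}) (g : T -> T)
    (f1 f2 : T -> R) :
    {in X, forall x, g x \in X} -> {in X &, injective g} ->
    {in X, forall x, f1 (g x) = f2 x} ->
  forall v, #|[set x in X | f1 x == v]| = #|[set x in X | f2 x == v]|.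
Proof.
move=> gX g_inj f12 v.
have gXE : g @: X = X.
  apply/eqP; rewrite eqEcard card_in_imset // leqnn andbT.
  by apply/subsetP => _ /imsetP[x Xx ->]; apply: gX.
rewrite -[RHS](card_in_imset (f := g)); last first.
  by move=> x y; rewrite !inE => /andP[Xx _] /andP[Xy _]; apply: g_inj.
apply: eq_card => y; rewrite inE; apply/andP/imsetP => [[Xy f1y]|[x]].
  have /imsetP[x Xx y_gx] : y \in g @: X by rewrite gXE.
  by exists x; rewrite // inE Xx -f12 // -y_gx.
by rewrite inE => /andP[Xx f2x] ->; rewrite f12 // gX.
Qed.

(** Inversion over the subset lattice: by induction on [#|A|], the terms of the proper subsets of
    [A] cancel. *)
Lemma card_eq_of_subset (T I : finType) (h : T -> {set I}) (P Q : pred T) :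
    (forall A : {set I}, #|[set x | (h x \subset A) && P x]| =
               #|[set x | (h x \subset A) && Q x]|) ->
  forall A : {set I}, #|[set x | (h x == A) && P x]| =
    #|[set x | (h x == A) && Q x]|.
Proof.
move=> eqPQ A; have [k] := ubnP #|A|; elim: k A => // k IH A le_A.
have split_sub (Z : pred T) : #|[set x | (h x \subset A) && Z x]| =
    #|[set x | (h x == A) && Z x]| +
    \sum_(A' : {set I} | A' \proper A) #|[set x | (h x == A') && Z x]|.
  transitivity (\sum_(A' : {set I} | A' \subset A)
                  #|[set x | (h x == A') && Z x]|).
    rewrite -sum1_card (partition_big h (fun A' => A' \subset A)) /=.
      apply: eq_bigr => A' sub; rewrite -sum1_card; apply: eq_bigl => x.
      by rewrite !inE andbAC; case: eqP => [->|]; rewrite ?sub ?andbF //= andbT.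
    by move=> x; rewrite inE => /andP[].
  rewrite (bigD1 A) //=; congr (_ + _); apply: eq_bigl => A'.
  by rewrite properEneq andbC.
have := eqPQ A; rewrite !split_sub (eq_bigr (fun A' =>
  #|[set x | (h x == A') && Q x]|)); first by move/addIn.
by move=> A' /proper_card lt_A'; apply: IH; apply: leq_trans lt_A' _.
Qed.

Lemma card_Iligne_subset n (A B : {set 'I_n}) (w : seq nat) :
  #|[set s : 'S_n | (Iligne s \subset A) &&
      ((sort leq (Mc s), El n (Mc s)) == (w, B))]| =
  #|[set s : 'S_n | (Iligne s \subset A) &&
      ((sort leq (Ic s), El n (Ic s)) == (w, B))]|.
Proof.
pose c k := [forall i : 'I_n, (i + k.+1 == n) ==> (i \notin A)].
have [g [gD g_inj g_perm g_st]] := rearrangement_exists c n.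
pose D r := [/\ size r = n, bounded 1 r & weakly_decreasing_at c r].
pose X := [set s : 'S_n | Iligne s \subset A].
have XD s : s \in X -> D (rev (Ic s)).
  rewrite inE => /Iligne_subset dec; split=> //;
    first by rewrite size_rev size_Lc.
  by have [] := Ic_state s.
(* [G] is [g] transported through [Ic]; outside [X] its value is arbitrary. *)
have exG (s : 'S_n) : exists t : 'S_n, s \in X -> rev (Ic t) = g (rev (Ic s)).
  have [Xs|_] := boolP (s \in X); last by exists s.
  have [sz_g bnd_g _] := gD _ (XD s Xs).
  have [||t tE] := @Ic_surj n (rev (g (rev (Ic s))));
    rewrite ?size_rev ?revK //.
  by exists t => _; rewrite tE revK.
have [G GP] := fin_all_exists exG.
have setE f : [set s : 'S_n | (Iligne s \subset A) && (f s == (w, B))] =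
    [set s in X | f s == (w, B)] by apply/setP => s; rewrite !inE.
rewrite !setE; apply: (@card_inj_transfer _ _ X G).
- move=> s Xs; rewrite inE; apply/Iligne_subset; rewrite (GP s Xs).
  by have [] := gD _ (XD s Xs).
- move=> s t Xs Xt eq_G; apply/Ic_inj/(can_inj revK).
  by apply: g_inj (XD s Xs) (XD t Xt) _; rewrite -!GP // eq_G.
move=> s Xs; have [sz bnd _] := XD s Xs.
have [_ st lab] := Ic_state (G s).
rewrite GP // in st lab; rewrite El_Mc; congr (_, _).
  apply/(perm_sortP leq_total leq_trans anti_leq).
  have := g_perm _ (XD s Xs).
  by rewrite lab perm_rev perm_sym perm_rev perm_sym.
(* Here [u] is the preimage of [Ic s] under [Mc], so [El n (Ic s)] is [Ligne u], and [u] has the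
   same final state as [G s]. *)
have [||u uM u_st] := @Mc_surj n (Ic s) => //; first by rewrite -size_rev.
by rewrite -uM El_Mc; apply: Ligne_state; rewrite u_st -st g_st //; apply: XD.
Qed.

Theorem theorem1 (n : nat) (n_ge1 : 1 <= n)
    (A : {set 'I_n}) (w : seq nat) (B : {set 'I_n})
    (subA : A \subset [set i : 'I_n | 0 < i])
    (size_w : size w = n)
    (subB : B \subset [set i : 'I_n | 0 < i]) :
  #|[set s : 'S_n |
      (Iligne s, sort leq (Mc s), El n (Mc s)) == (A, w, B)]| =
  #|[set s : 'S_n |
      (Iligne s, sort leq (Ic s), El n (Ic s)) == (A, w, B)]|.
Proof.
have tripleE (f : 'S_n -> seq nat) :
  [set s | (Iligne s, sort leq (f s), El n (f s)) == (A, w, B)] =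
  [set s | (Iligne s == A) && ((sort leq (f s), El n (f s)) == (w, B))].
  by apply/setP => s; rewrite !inE !xpair_eqE andbA.
rewrite !tripleE; apply: card_eq_of_subset => A'.
exact: card_Iligne_subset.
Qed.
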